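(* Let $n \geq 2$ be an integer. The Levi subalgebra $\mathfrak l = \mathcal A \oplus \mathcal H$ of the stochastic Lie algebra $\mathfrak s(n,\mathbb R)$ is isomorphic, as a real Lie algebra, to the special linear Lie algebra $\mathfrak{sl}(n-1,\mathbb R)$.
   Context: The stochastic Lie algebra is $\mathfrak s(n,\mathbb R)=\{A\in\mathbb R^{n\times n}: A\mathbf 1=0\}$, where $\mathbf 1\in\mathbb R^n$ is the vector with all entries equal to $1$, with bracket the matrix commutator $[A,B]=AB-BA$. Fix an orthonormal basis $v_1,\ldots,v_{n-1}$ of the hyperplane $\{x\in\mathbb R^n: x_1+\cdots+x_n=0\}$. For $a,b\in\mathbb R^n$, $a\otimes b$ denotes the $n\times n$ matrix $(a_ib_j)_{i,j}$. Set $A_{ij}=v_i\otimes v_j$ for $i,j\in\{1,\ldots,n-1\}$, $i\neq j$, and $$\mathcal A=\mathrm{span}\{A_{ij}: i\neq j\},\qquad \mathcal H=\Big\{\sum_{\ell=1}^{n-1}\gamma_\ell\,(v_\ell\otimes v_\ell): \gamma_\ell\in\mathbb R,\ \sum_{\ell=1}^{n-1}\gamma_\ell=0\Big\},\qquad \mathfrak l=\mathcal A\oplus\mathcal H.$$ The subspace $\mathfrak l$ is the Lie subalgebra of $\mathfrak s(n,\mathbb R)$ consisting of the real traceless $n\times n$ matrices with all row and column sums equal to zero. *)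

(* Defs.v *)
From HB Require Import structures.
From mathcomp Require Import all_boot all_order all_algebra.
From mathcomp Require Import reals.

Set Implicit Arguments.
Unset Strict Implicit.
Unset Printing Implicit Defensive.

Import Order.TTheory GRing.Theory Num.Theory.
Local Open Scope ring_scope.

Section MatrixLieAlgebras.
Variable R : realType.

Definition lie_bracket n (A B : 'M[R]_n) : 'M[R]_n := A *m B - B *m A.

Definition lie_closed n (V : {vspace 'M[R]_n}) : Prop :=
  forall A B, A \in V -> B \in V -> lie_bracket A B \in V.

Record matLieAlg n := MatLieAlg {
  lie_space :> {vspace 'M[R]_n};
  lie_spaceP : lie_closed lie_space }.

Definition lie_br n (g : matLieAlg n) (x y : subvs_of g) : subvs_of g :=
  Subvs (lie_spaceP (subvsP x) (subvsP y)).

(* The two Lie algebras may consist of matrices of different sizes. *)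
Definition lie_isomorphic m n (g : matLieAlg m) (h : matLieAlg n) : Prop :=
  exists f : {linear subvs_of g -> subvs_of h},
    bijective f /\ forall x y, f (lie_br x y) = lie_br (f x) (f y).

Definition sl_space n : {vspace 'M[R]_n} :=
  lker (linfun (mxtrace : 'M[R]_n -> R^o)).

Lemma mem_sl n (A : 'M[R]_n) : (A \in sl_space n) = (\tr A == 0).
Proof. by rewrite memv_ker lfunE. Qed.

Lemma sl_closed n : lie_closed (sl_space n).
Proof. by move=> A B _ _; rewrite mem_sl linearB /= mxtrace_mulC subrr. Qed.

Definition sl n : matLieAlg n := MatLieAlg (@sl_closed n).

Definition ones n : 'cV[R]_n := const_mx 1.

Definition stochastic_space n : {vspace 'M[R]_n} :=
  lker (linfun (mulmxr (ones n))).

Lemma mem_stochastic n (A : 'M[R]_n) :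
  (A \in stochastic_space n) = (A *m ones n == 0).
Proof. by rewrite memv_ker lfunE. Qed.

Lemma stochastic_closed n : lie_closed (stochastic_space n).
Proof.
move=> A B; rewrite !mem_stochastic => /eqP hA /eqP hB.
by rewrite mulmxBl -!mulmxA hA hB !mulmx0 subrr.
Qed.

Definition stochastic n : matLieAlg n := MatLieAlg (@stochastic_closed n).

End MatrixLieAlgebras.

Section LeviSubalgebra.
Variable R : realType.

Definition sum_entries n (x : 'cV[R]_n) : R^o := \sum_i x i 0.

Fact sum_entries_is_linear n : linear (@sum_entries n).
Proof.
move=> a x y; rewrite /sum_entries scaler_sumr -big_split /=.
by apply: eq_bigr => i _; rewrite !mxE.
Qed.

HB.instance Definition _ n :=
  GRing.isLinear.Build R 'cV[R]_n R^o _ (@sum_entries n)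
    (@sum_entries_is_linear n).

Definition hyperplane n : {vspace 'cV[R]_n} := lker (linfun (@sum_entries n)).

Lemma mem_hyperplane n (x : 'cV[R]_n) :
  (x \in hyperplane n) = (\sum_i x i 0 == 0).
Proof. by rewrite memv_ker lfunE. Qed.

Definition dot n (x y : 'cV[R]_n) : R := \sum_i x i 0 * y i 0.

Definition orthonormal_basis n m (V : {vspace 'cV[R]_n})
    (v : m.-tuple 'cV[R]_n) : Prop :=
  basis_of V v /\ forall i j, dot (tnth v i) (tnth v j) = (i == j)%:R.

Definition tensor n (a b : 'cV[R]_n) : 'M[R]_n :=
  \matrix_(i, j) (a i 0 * b j 0).

Variables n m : nat.
Variable v : m.-tuple 'cV[R]_n.

Definition calA : {vspace 'M[R]_n} :=
  <<[seq tensor (tnth v p.1) (tnth v p.2)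
      | p : 'I_m * 'I_m in [pred p | p.1 != p.2]]>>%VS.

Definition diag_comb (gamma : 'cV[R]_m) : 'M[R]_n :=
  \sum_l gamma l 0 *: tensor (tnth v l) (tnth v l).

Fact diag_comb_is_linear : linear diag_comb.
Proof.
move=> a x y; rewrite /diag_comb scaler_sumr -big_split /=.
by apply: eq_bigr => i _; rewrite !mxE scalerDl scalerA.
Qed.

HB.instance Definition _ :=
  GRing.isLinear.Build R 'cV[R]_m 'M[R]_n _ diag_comb diag_comb_is_linear.

Definition calH : {vspace 'M[R]_n} := (linfun diag_comb @: hyperplane m)%VS.

Lemma mem_calH (M : 'M[R]_n) :
  M \in calH <->
  exists gamma : 'I_m -> R, \sum_l gamma l = 0 /\
    M = \sum_l gamma l *: tensor (tnth v l) (tnth v l).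
Proof.
split=> [/memv_imgP[g] | [g [g0 ->]]].
  rewrite mem_hyperplane lfunE /= => /eqP g0 ->.
  by exists (fun l => g l 0).
apply/memv_imgP; exists (\col_l g l).
  by rewrite mem_hyperplane -[X in _ == X]g0; apply/eqP; apply: eq_bigr => i _; rewrite mxE.
by rewrite lfunE /=; apply: eq_bigr => i _; rewrite mxE.
Qed.

Definition levi : {vspace 'M[R]_n} := (calA + calH)%VS.

End LeviSubalgebra.

(* Main.v *)
Require Import Defs.
From HB Require Import structures.
From mathcomp Require Import all_boot all_order all_algebra.
From mathcomp Require Import reals.
Import Order.TTheory GRing.Theory Num.Theory.
Local Open Scope ring_scope.

(* Let V be the n x (n-1) matrix with columns v_1, ..., v_(n-1).
   Orthonormality says V^T V = 1, so B |-> V B V^T is an injective algebra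
   morphism with left inverse A |-> V^T A V. It sends the elementary matrix
   E_ij to v_i (x) v_j, hence sl(n-1) onto l; and the image kills the vector
   of ones because each v_i has zero sum. *)

Section Frame.
Context {R : realType} {n m : nat}.
Variable v : m.-tuple 'cV[R]_n.

Definition frame : 'M[R]_(n, m) := \matrix_(i, j) tnth v j i 0.

Definition expand (B : 'M[R]_m) : 'M[R]_n := frame *m B *m frame^T.

Definition compress (A : 'M[R]_n) : 'M[R]_m := frame^T *m A *m frame.

Fact expand_is_linear : linear expand.
Proof. by move=> a A B; rewrite /expand mulmxDr mulmxDl -scalemxAr -scalemxAl. Qed.

HB.instance Definition _ :=
  GRing.isLinear.Build R 'M[R]_m 'M[R]_n _ expand expand_is_linear.

Fact compress_is_linear : linear compress.
Proof.
by move=> a A B; rewrite /compress mulmxDr mulmxDl -scalemxAr -scalemxAl.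
Qed.

HB.instance Definition _ :=
  GRing.isLinear.Build R 'M[R]_n 'M[R]_m _ compress compress_is_linear.

Lemma expand_delta i j :
  expand (delta_mx i j) = tensor (tnth v i) (tnth v j).
Proof.
(* Factor $E_{ij} = e_i e_j^T$ through a one-dimensional space, so that $V E_{ij} V^T = (V e_i)(V
   e_j)^T$. *)
apply/matrixP=> k l; rewrite -(mul_delta_mx (0 : 'I_1)) /expand mulmxA -mulmxA.
by rewrite -colE -rowE !mxE big_ord1 !mxE.
Qed.

Lemma expand_tensor_sum (B : 'M[R]_m) :
  expand B = \sum_i \sum_j B i j *: tensor (tnth v i) (tnth v j).
Proof.
rewrite {1}[B]matrix_sum_delta linear_sum; apply: eq_bigr => i _.
rewrite linear_sum; apply: eq_bigr => j _.
by rewrite linearZ /= expand_delta.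
Qed.

Lemma expand_diag (gamma : 'cV[R]_m) :
  expand (diag_mx gamma^T) = diag_comb v gamma.
Proof.
rewrite expand_tensor_sum /diag_comb; apply: eq_bigr => i _.
rewrite (bigD1 i) //= big1 => [|j ji]; first by rewrite !mxE eqxx addr0.
by rewrite !mxE eq_sym (negPf ji) scale0r.
Qed.

(** Traceless matrices are spanned by the off-diagonal units, which map to the generators of [calA],
    and the traceless diagonal matrices, which map onto [calH]. *)
Lemma levi_expand : levi v = (linfun expand @: sl_space R m)%VS.
Proof.
apply/eqP; rewrite eqEsubv; apply/andP; split.
  rewrite subv_add; apply/andP; split.
    apply/span_subvP => _ /imageP[[i j] /= ij ->].
    apply/memv_imgP; exists (delta_mx i j); last by rewrite lfunE /= expand_delta.
    rewrite mem_sl /mxtrace big1 // => k _; rewrite mxE.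
    by case: (k =P i) => //= ->; rewrite (negPf ij).
  apply/subvP => _ /memv_imgP[g gH ->]; rewrite lfunE /= -expand_diag.
  apply/memv_imgP; exists (diag_mx g^T); last by rewrite lfunE.
  rewrite mem_hyperplane in gH; rewrite mem_sl mxtrace_diag; apply/eqP.
  by rewrite -[RHS](eqP gH); apply: eq_bigr => i _; rewrite mxE.
apply/subvP => _ /memv_imgP[B trB ->]; rewrite lfunE /= expand_tensor_sum.
(* The diagonal of [B]: its entries sum to the trace of [B], so [diag_comb v D] lies in [calH]. *)
pose D := \col_i B i i.
have -> : \sum_i \sum_j B i j *: tensor (tnth v i) (tnth v j) =
    \sum_i \sum_(j | i != j) B i j *: tensor (tnth v i) (tnth v j)
    + diag_comb v D.
  rewrite -big_split; apply: eq_bigr => i _ /=.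
  rewrite (bigD1 i) //= addrC mxE; congr (_ + _).
  by apply: eq_bigl => j; rewrite eq_sym.
apply: memv_add.
  apply: memv_suml => i _; apply: memv_suml => j ij; apply/memvZ/memv_span.
  by apply/imageP; exists (i, j).
apply/memv_imgP; exists D; last by rewrite lfunE.
rewrite mem_sl in trB; rewrite mem_hyperplane; apply/eqP.
by rewrite -[RHS](eqP trB); apply: eq_bigr => i _; rewrite mxE.
Qed.

Lemma levi_stochastic :
  (forall i, tnth v i \in hyperplane R n) -> (levi v <= stochastic R n)%VS.
Proof.
move=> vH; rewrite levi_expand; apply/subvP => _ /memv_imgP[B _ ->].
rewrite lfunE /= mem_stochastic /expand -!mulmxA.
suff -> : frame^T *m ones R n = 0 by rewrite !mulmx0.
apply/matrixP => i j; rewrite !mxE.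
have := vH i; rewrite mem_hyperplane => /eqP vi0; rewrite -[RHS]vi0.
by apply: eq_bigr => k _; rewrite !mxE mulr1.
Qed.

Hypothesis v_orthonormal : forall i j, dot (tnth v i) (tnth v j) = (i == j)%:R.

Lemma frame_orthonormal : frame^T *m frame = 1%:M.
Proof.
apply/matrixP => i j; rewrite !mxE -v_orthonormal.
by apply: eq_bigr => k _; rewrite !mxE.
Qed.

Lemma expandK : cancel expand compress.
Proof.
move=> B; rewrite /compress /expand !mulmxA frame_orthonormal mul1mx.
by rewrite -mulmxA frame_orthonormal mulmx1.
Qed.

Lemma expandM A B : expand (A *m B) = expand A *m expand B.
Proof.
by rewrite /expand -!mulmxA (mulmxA frame^T frame) frame_orthonormal mul1mx.
Qed.

Lemma expand_bracket A B :
  expand (lie_bracket A B) = lie_bracket (expand A) (expand B).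
Proof. by rewrite /lie_bracket linearB /= !expandM. Qed.

(** [compress] turns each generator $v_a \otimes v_b$ of [calA] back into $E_{ab}$ with $a \neq b$,
    whose diagonal is zero. *)
Lemma compress_calA_diag A i : A \in calA v -> compress A i i = 0.
Proof.
move=> /coord_span ->; rewrite linear_sum summxE big1 // => k _.
rewrite linearZ mxE /=.
set t := _`_k.
have /imageP[[a b] /= ab ->] : t \in [seq tensor (tnth v p.1) (tnth v p.2)
    | p : 'I_m * 'I_m in [pred p | p.1 != p.2]] by rewrite mem_nth ?size_image.
rewrite -expand_delta expandK mxE.
by case: (i =P a) => [->|] /=; rewrite ?(negPf ab) mulr0.
Qed.

Lemma directv_calA_calH : directv (calA v + calH v).
Proof.
apply/directv_addP/eqP; rewrite -subv0; apply/subvP => A.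
rewrite memv_cap => /andP[AA /memv_imgP[g _]]; rewrite lfunE /= => Ag.
suff g0 : g = 0 by rewrite Ag g0 linear0 mem0v.
(* On [calH], [compress] returns the diagonal matrix of the coefficients [g]; on [calA] its diagonal
   vanishes. *)
apply/matrixP => i j; rewrite ord1 mxE -(compress_calA_diag A i AA).
by rewrite Ag -expand_diag expandK !mxE eqxx.
Qed.

(** [levi v] is the image of a Lie algebra under a bracket-preserving linear map. *)
Lemma levi_lie_closed : lie_closed (levi v).
Proof.
rewrite levi_expand => _ _ /memv_imgP[A trA ->] /memv_imgP[B trB ->].
rewrite !lfunE /= -expand_bracket; apply/memv_imgP.
by exists (lie_bracket A B); [apply: sl_closed | rewrite lfunE].
Qed.

Lemma expand_levi B : B \in sl_space R m -> expand B \in levi v.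
Proof.
by move=> Bsl; rewrite levi_expand; apply/memv_imgP; exists B; rewrite ?lfunE.
Qed.

Lemma levi_expandP (A : 'M[R]_n) :
  A \in levi v -> exists2 B, B \in sl_space R m & A = expand B.
Proof.
by rewrite levi_expand => /memv_imgP[B Bsl ->]; exists B; rewrite ?lfunE.
Qed.

Lemma levi_isomorphic_sl :
  lie_isomorphic (MatLieAlg levi_lie_closed) (sl R m).
Proof.
pose g : matLieAlg R n := MatLieAlg levi_lie_closed.
pose f : {linear subvs_of g -> subvs_of (sl R m)} :=
  vsproj (sl R m) \o (compress \o vsval).
(* [vsproj] is a linear projection and keeps a matrix unchanged only inside the target space.
   Writing [x] as [expand B] with [B] traceless guarantees this, so [f] really returns [B]. *)
have fE (x : subvs_of g) B : B \in sl_space R m -> vsval x = expand B ->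
    vsval (f x) = B.
  by move=> Bsl xB; rewrite /f /= xB expandK vsprojK.
exists f; split.
  exists (fun y => vsproj g (expand (vsval y))) => [x|y]; apply: val_inj => /=.
    have [B Bsl xB] := levi_expandP _ (subvsP x).
    by rewrite -/(f x) (fE x B Bsl xB) vsprojK // expand_levi.
  by rewrite vsprojK ?expand_levi ?subvsP // expandK vsprojK ?subvsP.
move=> x y; apply: val_inj.
have [A Asl xA] := levi_expandP _ (subvsP x).
have [B Bsl yB] := levi_expandP _ (subvsP y).
(* The bracket of [x] and [y] is [expand] of $[A,B]$, which is traceless, so [fE] applies. *)
have -> : val (f (lie_br x y)) = lie_bracket A B.
  apply: fE; first exact: sl_closed.
  by rewrite expand_bracket -xA -yB.
by rewrite -(fE x A Asl xA) -(fE y B Bsl yB).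
Qed.

End Frame.

(** The closure proof is bound existentially because it is what makes [levi v] a [matLieAlg]. Zero
    column sums of the frame give the inclusion in [stochastic]; orthonormality gives directness and
    the isomorphism. *)
Theorem theorem4p1 (R : realType) (n : nat) (n_ge2 : (2 <= n)%N)
    (v : (n.-1).-tuple 'cV[R]_n)
    (v_onb : orthonormal_basis (hyperplane R n) v) :
  [/\ directv (calA v + calH v),
      (levi v <= stochastic R n)%VS
    & exists levi_closed : lie_closed (levi v),
        lie_isomorphic (MatLieAlg levi_closed) (sl R n.-1)].
Proof.
have [vB vO] := v_onb; split.
- exact: directv_calA_calH.
- by apply: levi_stochastic => i; apply: basis_mem vB _; apply: mem_tnth.
- by exists (levi_lie_closed v vO); apply: levi_isomorphic_sl.
Qed.
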